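(* Let $K$ be a knot type in $\mathbb{R}^3$ with mirror image $\overline{K}$, and fix a reflection $r$ of $\mathbb{R}^3$. Then $\tau_\Lambda([\gamma])=[r\circ\gamma]$ is a well-defined homeomorphism $$\tau_\Lambda:Y_\Lambda(K)\longrightarrow Y_\Lambda(\overline{K})$$ for every $\Lambda$, compatible with the inclusions of sublevels. If $K$ is amphichiral, $\tau$ is an involution of the whole filtration of $K$ and restricts to an involution of $I(K)$, so that $\{Y_\Lambda(K)\}_\Lambda$ is a filtered $\mathbb{Z}/2$-space.
   Context: Knot types are tame types of knots (one component) in Euclidean $\mathbb{R}^3$; $K$ is amphichiral if $K=\overline{K}$. For an embedded closed $C^{1,1}$ curve $\gamma$ ($C^1$ with Lipschitz unit tangent), $\operatorname{Len}(\gamma)$ is the length and the thickness $\operatorname{Thi}(\gamma)$ is the reach of its image, i.e. the supremum of $r>0$ for which the closed $r$-neighbourhood is an embedded solid torus that is the union of the closed normal discs of radius $r$; equivalently, $\operatorname{Thi}(\gamma)$ is the infimum of the radii of circles through three distinct points of $\gamma$. The minimal ropelength is $m_K=\inf\{\operatorname{Len}(\gamma)/\operatorname{Thi}(\gamma):[\gamma]=K\}$. Represent configurations by constant-speed $C^{1,1}$ embeddings $\gamma:S^1=\mathbb{R}/2\pi\mathbb{Z}\to\mathbb{R}^3$, and identify two of them when they differ by an orientation-preserving Euclidean isometry and a rotation or reflection of the source circle. For $m_K\le\Lambda<\infty$, $$Y_\Lambda(K)=\{[\gamma]:\gamma\text{ has knot type }K,\ \operatorname{Thi}(\gamma)\ge1,\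 \operatorname{Len}(\gamma)\le\Lambda\},$$ topologised as a quotient of the constant-speed $C^1$ topology. The ideal stratum is $I(K)=Y_{m_K}(K)$. *)

(* Defs.v *)
From HB Require Import structures.
From mathcomp Require Import all_boot all_order all_algebra.
From mathcomp Require Import all_classical all_reals all_analysis.

Set Implicit Arguments.
Unset Strict Implicit.
Unset Printing Implicit Defensive.

Import Order.TTheory GRing.Theory Num.Theory.
Import numFieldNormedType.Exports.

Local Open Scope classical_set_scope.
Local Open Scope ring_scope.
Local Open Scope quotient_scope.

(** * Euclidean 3-space *)

(* The library norm of ['rV[R]_3] is the sup norm: it induces the usual
   topology, but all metric notions below use [enorm]. *)
Notation "''E' R" := ('rV[R]_3) (at level 8, R at level 2) : type_scope.

Definition edot (R : realType) (u v : 'E R) : R := (u *m v^T) 0 0.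

Definition enorm (R : realType) (v : 'E R) : R := Num.sqrt (edot v v).

Definition is_homeomorphism (S T : topologicalType) (f : S -> T) : Prop :=
  exists g : T -> S, [/\ cancel f g, cancel g f, continuous f & continuous g].

(* Reflection in the affine plane [{x | edot x n = c}]. *)
Definition plane_reflection (R : realType) (n : 'E R) (c : R) (x : 'E R) :
  'E R := x - (2 * (edot x n - c)) *: n.

Definition is_reflection (R : realType) (r : 'E R -> 'E R) : Prop :=
  exists (n : 'E R) (c : R), enorm n = 1 /\ r = plane_reflection n c.

(* Lifts to [R] of the rotations ([e = false]) and reflections ([e = true]) of
   the circle [R / 2 pi Z]. *)
Definition circle_isometry (R : realType) (e : bool) (s t : R) : R :=
  (-1) ^+ e * t + s.

Definition special_orthogonal (R : realType) (A : 'M[R]_3) : Prop :=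
  A *m A^T = 1%:M /\ \det A = 1.

(** * Knots and knot types *)

(* A function on the circle [R / 2 pi Z] is a [2 pi]-periodic function on [R].
   Such a function is injective on the circle iff it is so on [[0, 2 pi[]. *)
Definition simple_closed (R : realType) (g : R -> 'E R) : Prop :=
  periodic g (2 * pi) /\ set_inj `[0, 2 * pi[ g.

Definition is_knot (R : realType) (k : set 'E R) : Prop :=
  exists g : R -> 'E R, [/\ continuous g, simple_closed g & k = range g].

Definition ambient_isotopic (R : realType) (k l : set 'E R) : Prop :=
  exists H : R -> 'E R -> 'E R,
    [/\ {within [set p : R * 'E R | p.1 \in `[0, 1]],
           continuous (fun p => H p.1 p.2)},
        forall t, t \in `[0, 1] -> is_homeomorphism (H t),
        forall x, H 0 x = x
      & H 1 @` k = l].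

Definition esegment (R : realType) (a b : 'E R) : set 'E R :=
  [set (1 - t) *: a + t *: b | t in `[0, 1]].

Definition polygonal_knot (R : realType) (k : set 'E R) : Prop :=
  is_knot k /\
  exists s : seq ('E R * 'E R),
    k = [set x | exists2 ab, ab \in s & esegment ab.1 ab.2 x].

Definition tame_knot (R : realType) (k : set 'E R) : Prop :=
  is_knot k /\ exists2 p, polygonal_knot p & ambient_isotopic k p.

(* A knot type is the ambient isotopy class of a tame (unoriented) knot. *)
Definition is_knot_type (R : realType) (K : set (set 'E R)) : Prop :=
  exists2 k, tame_knot k & K = [set l | ambient_isotopic k l].

(* Mirror images are taken in the plane where the last coordinate vanishes. *)
Definition mirror (R : realType) (K : set (set 'E R)) : set (set 'E R) :=
  [set plane_reflection (delta_mx 0 ord_max) 0 @` k | k in K].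

Definition amphichiral (R : realType) (K : set (set 'E R)) : Prop :=
  mirror K = K.

(** * C^{1,1} curves, thickness and ropelength *)

Definition unit_tangent (R : realType) (g : R -> 'E R) (t : R) : 'E R :=
  (enorm (derive1 g t))^-1 *: derive1 g t.

Definition closed_C11 (R : realType) (g : R -> 'E R) : Prop :=
  [/\ simple_closed g,
      forall t, derivable g t 1,
      continuous (derive1 g),
      forall t, derive1 g t != 0
    & exists k : R, forall s t,
        enorm (unit_tangent g s - unit_tangent g t) <= k * `|s - t|].

Definition constant_speed (R : realType) (g : R -> 'E R) : Prop :=
  exists v : R, forall t, enorm (derive1 g t) = v.

Definition len (R : realType) (g : R -> 'E R) : R :=
  \int[lebesgue_measure]_(t in `[0, 2 * pi]) enorm (derive1 g t).

(* Federer's reach: the supremum of the [r > 0] such that every point at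
   distance less than [r] from [A] has a unique nearest point in [A].  For the
   image of a closed C^{1,1} curve this set of radii is nonempty and bounded, so
   that the real-valued [sup] is the genuine supremum. *)
Definition reach (R : realType) (A : set 'E R) : R :=
  sup [set r : R | 0 < r /\
    forall x a, A a -> enorm (x - a) < r ->
      exists! b, A b /\ forall c, A c -> enorm (x - b) <= enorm (x - c)].

Definition thi (R : realType) (g : R -> 'E R) : R := reach (range g).

Definition ropelength (R : realType) (g : R -> 'E R) : R := len g / thi g.

Definition min_ropelength (R : realType) (K : set (set 'E R)) : R :=
  inf [set x | exists g : R -> 'E R,
    [/\ closed_C11 g, K (range g) & x = ropelength g]].

(** * Configurations *)

Record config (R : realType) (K : set (set 'E R)) (L : R) := Config {
  curve :> R -> 'E R;
  curve_closed_C11 : closed_C11 curve;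
  curve_constant_speed : constant_speed curve;
  curve_knot_type : K (range curve);
  curve_thi : 1 <= thi curve;
  curve_len : len curve <= L
}.

HB.instance Definition _ (R : realType) (K : set (set 'E R)) (L : R) :=
  gen_eqMixin (config K L).
HB.instance Definition _ (R : realType) (K : set (set 'E R)) (L : R) :=
  gen_choiceMixin (config K L).

(* The C^1 topology: uniform convergence of the curve and of its derivative. *)
Definition jet (R : realType) (K : set (set 'E R)) (L : R) (g : config K L) :
    {uniform R -> 'E R} * {uniform R -> 'E R} :=
  ((g : R -> 'E R), derive1 g).

HB.instance Definition _ (R : realType) (K : set (set 'E R)) (L : R) :=
  Topological.copy (config K L) (initial_topology (@jet R K L)).

Definition congruent (R : realType) (g h : R -> 'E R) : Prop :=
  exists (A : 'M[R]_3) (b : 'E R) (e : bool) (s : R),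
    special_orthogonal A /\ forall t, h t = g (circle_isometry e s t) *m A + b.

Lemma congruent_refl (R : realType) (g : R -> 'E R) : congruent g g.
Proof.
exists 1%:M, 0, false, 0; split=> [|t].
  by split; [rewrite trmx1 mulmx1 | rewrite det1].
by rewrite /circle_isometry expr0 mul1r addr0 mulmx1 addr0.
Qed.

Lemma congruent_sym (R : realType) (g h : R -> 'E R) :
  congruent g h -> congruent h g.
Proof.
move=> [A [b [e [s [[AAT dA] hE]]]]].
exists A^T, (- (b *m A^T)), e, (- (-1) ^+ e * s); split=> [|t].
  by split; [rewrite trmxK; exact: mulmx1C | rewrite det_tr].
rewrite hE mulmxDl -mulmxA AAT mulmx1 addrK; congr (g _).
rewrite /circle_isometry mulrDr mulrA -expr2 sqrr_sign mul1r.
by rewrite !mulNr mulrN mulrA -expr2 sqrr_sign mul1r subrK.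
Qed.

Lemma congruent_trans (R : realType) (g h k : R -> 'E R) :
  congruent g h -> congruent h k -> congruent g k.
Proof.
move=> [A [b [e [s [[AAT dA] hE]]]]] [A' [b' [e' [s' [[AAT' dA'] kE]]]]].
exists (A *m A'), (b *m A' + b'), (e (+) e'), ((-1) ^+ e * s' + s).
split=> [|t].
  split; last by rewrite det_mulmx dA dA' mulr1.
  by rewrite trmx_mul mulmxA -(mulmxA A) AAT' mulmx1.
rewrite kE hE mulmxDl mulmxA addrA; congr (g _ *m _ *m _ + _ + _).
by rewrite /circle_isometry signr_addb mulrDr mulrA addrA.
Qed.

Definition config_congruent (R : realType) (K : set (set 'E R)) (L : R) :
  rel (config K L) := fun g h => `[< congruent g h >].

Lemma config_congruentP (R : realType) (K : set (set 'E R)) (L : R) :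
  equiv_class_of (@config_congruent R K L).
Proof.
split=> [g|g h|h g k].
- exact/asboolP/congruent_refl.
- by apply/asboolP/asboolP => /congruent_sym.
- by move=> /asboolP gh /asboolP hk; apply/asboolP/(congruent_trans gh hk).
Qed.

Canonical config_equiv (R : realType) (K : set (set 'E R)) (L : R) :=
  EquivRelPack (@config_congruentP R K L).

(** * The sublevels Y_L(K) *)

Definition Y (R : realType) (K : set (set 'E R)) (L : R) : Type :=
  quotient_topology {eq_quot (config_equiv K L)}.

HB.instance Definition _ (R : realType) (K : set (set 'E R)) (L : R) :=
  Topological.on (Y K L).
HB.instance Definition _ (R : realType) (K : set (set 'E R)) (L : R) :=
  Quotient.on (Y K L).

Definition Yclass (R : realType) (K : set (set 'E R)) (L : R)
  (g : config K L) : Y K L := \pi_(Y K L) g.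

Definition ideal_stratum (R : realType) (K : set (set 'E R)) : Type :=
  Y K (min_ropelength K).
HB.instance Definition _ (R : realType) (K : set (set 'E R)) :=
  Topological.on (ideal_stratum K).

Definition config_incl (R : realType) (K : set (set 'E R)) (L M : R)
    (LM : L <= M) (g : config K L) : config K M :=
  Config (curve_closed_C11 g) (curve_constant_speed g) (curve_knot_type g)
    (curve_thi g) (le_trans (curve_len g) LM).

Definition Yincl (R : realType) (K : set (set 'E R)) (L M : R)
  (LM : L <= M) (y : Y K L) : Y K M := Yclass (config_incl LM (repr y)).

Lemma YinclE (R : realType) (K : set (set 'E R)) (L M : R) (LM : L <= M)
    (g : config K L) :
  Yincl LM (Yclass g) = Yclass (config_incl LM g).
Proof.
have /eqmodP/asboolP e : repr (Yclass g) = g %[mod {eq_quot (config_equiv K L)}].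
  exact: reprK.
by apply/eqmodP/asboolP.
Qed.

Definition Ycast (R : realType) (K K' : set (set 'E R)) (e : K = K') (L : R)
  (y : Y K L) : Y K' L := ecast k (Y k L) e y.

(* [f] is given by [[g] |-> [r \o g]]. *)
Definition is_postcomposition (R : realType) (r : 'E R -> 'E R)
    (K K' : set (set 'E R)) (L : R) (f : Y K L -> Y K' L) : Prop :=
  forall g : config K L, exists2 h : config K' L,
    (h : R -> 'E R) = r \o g & f (Yclass g) = Yclass h.

(** * Filtered Z/2-spaces *)

(* As Z/2 is discrete, continuity of each element suffices. *)
Definition is_Z2_action (T : topologicalType) (a : 'Z_2 -> T -> T) : Prop :=
  [/\ forall y, a 0 y = y,
      forall i j y, a (i + j) y = a i (a j y)
    & forall i, continuous (a i)].

Definition is_filtered_Z2_space (R : realType) (K : set (set 'E R))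
    (a : forall L : R, 'Z_2 -> Y K L -> Y K L) : Prop :=
  (forall L, min_ropelength K <= L -> is_Z2_action (a L)) /\
  (forall L M (LM : L <= M), min_ropelength K <= L ->
     continuous (@Yincl R K L M LM) /\
     forall i (y : Y K L), a M i (Yincl LM y) = Yincl LM (a L i y)).

(* Main.v *)
(* Thickness, length and constant speed are isometry invariants, so
   postcomposition with [r] is a C^1-homeomorphism of configuration spaces, and
   it respects congruence because conjugating a rotation by a reflection gives a
   rotation.  The mirror image of a knot type is taken in one fixed plane; any
   other reflection sends [K] to the same type because two reflections are joined
   by a path of reflections, which makes their composite ambient isotopic to the
   identity.  Everything on the quotients then follows from [r \o r = id]. *)
Require Import Defs.
From HB Require Import structures.
From mathcomp Require Import all_boot all_order all_algebra.
From mathcomp Require Import all_classical all_reals all_analysis.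
From mathcomp Require Import ring lra.

Set Implicit Arguments.
Unset Strict Implicit.
Unset Printing Implicit Defensive.

Import Order.TTheory GRing.Theory Num.Theory.
Import numFieldNormedType.Exports.

Local Open Scope classical_set_scope.
Local Open Scope ring_scope.

(** * The Euclidean inner product and norm on row vectors *)

Lemma edotE (R : realType) (u v : 'E R) :
  edot u v = \sum_(i < 3) u 0 i * v 0 i.
Proof. by rewrite /edot mxE; apply: eq_bigr => i _; rewrite mxE. Qed.

Lemma edotC (R : realType) (u v : 'E R) : edot u v = edot v u.
Proof. by rewrite !edotE; apply: eq_bigr => i _; rewrite mulrC. Qed.

Lemma edotDl (R : realType) (u v w : 'E R) :
  edot (u + v) w = edot u w + edot v w.
Proof. by rewrite /edot mulmxDl mxE. Qed.

Lemma edotZl (R : realType) (a : R) (u v : 'E R) :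
  edot (a *: u) v = a * edot u v.
Proof. by rewrite /edot -scalemxAl mxE. Qed.

Lemma edotDr (R : realType) (u v w : 'E R) :
  edot u (v + w) = edot u v + edot u w.
Proof. by rewrite edotC edotDl !(edotC _ u). Qed.

Lemma edotZr (R : realType) (a : R) (u v : 'E R) :
  edot u (a *: v) = a * edot u v.
Proof. by rewrite edotC edotZl edotC. Qed.

Lemma edot_ge0 (R : realType) (u : 'E R) : 0 <= edot u u.
Proof. by rewrite edotE; apply: sumr_ge0 => i _; rewrite -expr2 sqr_ge0. Qed.

Lemma edot_unit (R : realType) (u : 'E R) : enorm u = 1 -> edot u u = 1.
Proof.
move=> u1; rewrite -[LHS]sqr_sqrtr ?edot_ge0//.
by rewrite [_ ^+ 2]expr2 -/(enorm u) u1 mulr1.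
Qed.

Lemma enormZ (R : realType) (a : R) (u : 'E R) :
  enorm (a *: u) = `|a| * enorm u.
Proof.
by rewrite /enorm edotZl edotZr mulrA -expr2 sqrtrM ?sqr_ge0// sqrtr_sqr.
Qed.

Lemma enorm_mulmx (R : realType) (A : 'M[R]_3) (v : 'E R) :
  A *m A^T = 1%:M -> enorm (v *m A) = enorm v.
Proof.
by move=> AAT; rewrite /enorm /edot trmx_mul mulmxA -(mulmxA v) AAT mulmx1.
Qed.

(** The ambient topology comes from the sup norm, so the limit is taken coordinate by coordinate in
    the sum of products. *)
Lemma cvg_edot (R : realType) (T : Type) (F : set_system T) {FF : Filter F}
    (f g : T -> 'E R) (u v : 'E R) :
  f @ F --> u -> g @ F --> v -> (edot (f x) (g x)) @[x --> F] --> edot u v.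
Proof.
move=> fu gv; rewrite edotE; under eq_fun do rewrite edotE.
apply: cvg_big => [|i _]; [exact: add_continuous|apply: cvgM].
  exact: (cvg_comp _ _ fu (@coord_continuous _ _ _ _ _ _)).
exact: (cvg_comp _ _ gv (@coord_continuous _ _ _ _ _ _)).
Qed.

Lemma cvg_enorm (R : realType) (T : Type) (F : set_system T) {FF : Filter F}
    (f : T -> 'E R) (u : 'E R) :
  f @ F --> u -> (enorm (f x)) @[x --> F] --> enorm u.
Proof.
move=> fu; rewrite /enorm.
apply: (@cvg_comp _ _ _ (fun x => edot (f x) (f x)) Num.sqrt).
  exact: (cvg_edot fu fu).
exact: (@sqrt_continuous R).
Qed.

Lemma mulmxr_continuous (R : realType) (A : 'M[R]_3) :
  continuous (mulmxr A : 'E R -> 'E R).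
Proof.
rewrite (_ : mulmxr A = fun x : 'E R => \sum_i x 0 i *: row i A); last first.
  by apply/funext => x; rewrite /= mulmx_sum_row.
apply: continuous_big => [|i _ x]; first exact: add_continuous.
by apply: cvgZr_tmp; [exact: nbhs_filter|exact: coord_continuous].
Qed.

(** * Plane reflections as affine isometries *)

Definition householder (R : realType) (n : 'E R) : 'M[R]_3 :=
  1%:M - 2 *: (n^T *m n).

(** Separates the linear part, acting on rows from the right, from the translation. This is the
    affine form in which curves are treated below. *)
Lemma plane_reflectionE (R : realType) (n : 'E R) (c : R) :
  plane_reflection n c = fun x => x *m householder n + (2 * c) *: n.
Proof.
apply/funext => x; rewrite /plane_reflection /householder mulmxBr mulmx1.
rewrite -scalemxAr mulmxA [x *m _]mx11_scalar mul_scalar_mx -/(edot x n).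
by rewrite mulrBr scalerBl opprB addrA addrAC scalerA.
Qed.

Lemma householder_sym (R : realType) (n : 'E R) :
  (householder n)^T = householder n.
Proof.
by rewrite /householder linearB linearZ /= trmx1 trmx_mul trmxK.
Qed.

Lemma householder_sqr (R : realType) (n : 'E R) :
  enorm n = 1 -> householder n *m householder n = 1%:M.
Proof.
move=> n1; rewrite /householder mulmxBr mulmx1 mulmxBl mul1mx.
have -> : (2 *: (n^T *m n)) *m (2 *: (n^T *m n)) = (2 * 2) *: (n^T *m n).
  rewrite -scalemxAl -scalemxAr scalerA mulmxA -(mulmxA n^T).
  by rewrite [n *m n^T]mx11_scalar -/(edot n n) edot_unit// mulmx1.
apply/matrixP => i j; rewrite !mxE; ring.
Qed.

Lemma householder_orthogonal (R : realType) (n : 'E R) :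
  enorm n = 1 -> householder n *m (householder n)^T = 1%:M.
Proof. by move=> n1; rewrite householder_sym householder_sqr. Qed.

Lemma plane_reflectionK (R : realType) (n : 'E R) (c : R) :
  enorm n = 1 -> involutive (plane_reflection n c).
Proof.
move=> n1 x; rewrite /plane_reflection.
have -> : edot (x - (2 * (edot x n - c)) *: n) n = 2 * c - edot x n.
  by rewrite -scaleNr edotDl edotZl edot_unit//; ring.
by apply/rowP => i; rewrite !mxE; ring.
Qed.

Lemma plane_reflection_image2 (R : realType) (n : 'E R) (c : R) (k : set 'E R) :
  enorm n = 1 -> plane_reflection n c @` (plane_reflection n c @` k) = k.
Proof.
move=> n1; rewrite image_comp (_ : _ \o _ = id) ?image_id//.
by apply/funext => x; exact: plane_reflectionK.
Qed.

Lemma plane_reflection_isometry (R : realType) (n : 'E R) (c : R) (x y : 'E R) :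
  enorm n = 1 ->
  enorm (plane_reflection n c x - plane_reflection n c y) = enorm (x - y).
Proof.
move=> n1; rewrite plane_reflectionE opprD addrACA subrr addr0 -mulmxBl.
exact/enorm_mulmx/householder_orthogonal.
Qed.

(** A plane has two unit normals. This freedom of sign is used to join two normals by a segment that
    avoids the origin. *)
Lemma plane_reflection_opp (R : realType) (n : 'E R) (c : R) :
  plane_reflection (- n) (- c) = plane_reflection n c.
Proof.
apply/funext => x; rewrite /plane_reflection -[- n]scaleN1r edotZr.
by apply/rowP => i; rewrite !mxE; ring.
Qed.

(** Joint continuity in normal, offset and point, since in the isotopy of reflections all three
    vary. *)
Lemma cvg_plane_reflection (R : realType) (T : Type) (F : set_system T)
    {FF : Filter F} (n : T -> 'E R) (c : T -> R) (f : T -> 'E R)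
    (n0 : 'E R) (c0 : R) (x0 : 'E R) :
  n @ F --> n0 -> c @ F --> c0 -> f @ F --> x0 ->
  (plane_reflection (n x) (c x) (f x)) @[x --> F] --> plane_reflection n0 c0 x0.
Proof.
move=> nn0 cc0 fx0; apply: cvgB => //; apply: cvgZ => //.
by apply: cvgMl_tmp; apply: cvgB => //; exact: cvg_edot.
Qed.

Lemma plane_reflection_continuous (R : realType) (n : 'E R) (c : R) :
  continuous (plane_reflection n c).
Proof.
move=> x.
apply: (@cvg_plane_reflection _ _ (nbhs x) _ (fun=> n) (fun=> c) id).
- exact: cvg_cst.
- exact: cvg_cst.
- exact: cvg_id.
Qed.

(** * Ambient isotopies, and knot types under reflection *)

Lemma is_homeomorphism_comp (S T U : topologicalType) (f : S -> T) (g : T -> U) :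
  is_homeomorphism f -> is_homeomorphism g -> is_homeomorphism (g \o f).
Proof.
move=> [f' [fK f'K cf cf']] [g' [gK g'K cg cg']]; exists (f' \o g'); split.
- exact: can_comp.
- exact: can_comp.
- by move=> x; apply: continuous_comp; [exact: cf|exact: cg].
- by move=> x; apply: continuous_comp; [exact: cg'|exact: cf'].
Qed.

Lemma plane_reflection_homeomorphism (R : realType) (n : 'E R) (c : R) :
  enorm n = 1 -> is_homeomorphism (plane_reflection n c).
Proof.
move=> n1; exists (plane_reflection n c); split; first 2 last.
- exact: plane_reflection_continuous.
- exact: plane_reflection_continuous.
- exact: plane_reflectionK.
- exact: plane_reflectionK.
Qed.

Lemma ambient_isotopic_trans (R : realType) (k l m : set 'E R) :
  ambient_isotopic k l -> ambient_isotopic l m -> ambient_isotopic k m.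
Proof.
move=> [H [cH hH H0 <-]] [H' [cH' hH' H'0 <-]].
exists (fun t => H' t \o H t); split.
- apply/subspace_continuousP => p Ap.
  move/subspace_continuousP : cH => /(_ p Ap) cH.
  move/subspace_continuousP : cH' => /(_ (p.1, H p.1 p.2) Ap) cH'.
  set A := [set q : R * 'E R | q.1 \in `[0, 1]] in Ap cH cH' *.
  have cq : (q.1, H q.1 q.2) @[q --> within A (nbhs p)] --> (p.1, H p.1 p.2).
    apply: (@cvg_pair _ _ _ (within A (nbhs p)) (nbhs p.1) (nbhs (H p.1 p.2))).
      by apply: cvg_within_filter; exact: cvg_fst.
    exact: cH.
  (* [H'] is known to be continuous only within the strip of times in [[0, 1]], so convergence must
     hold within that strip; it does because the time coordinate is left unchanged. *)
  suff cq' : (q.1, H q.1 q.2) @[q --> within A (nbhs p)] -->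
      within A (nbhs (p.1, H p.1 p.2)) by exact: (cvg_comp _ _ cq' cH').
  move=> U /cq; rewrite /= !nbhs_simpl /= => Uq.
  by apply: filterS2 Uq (withinT _ _) => q; exact.
- move=> t t01; exact: is_homeomorphism_comp (hH t t01) (hH' t t01).
- by move=> x /=; rewrite H0 H'0.
- by rewrite image_comp.
Qed.

(* Both reflections belong to the family of reflections in the directions
   [(1 - t) n + t n'], normalized; it starts at the first one, with which it is
   composed to start at the identity. *)
Lemma plane_reflections_isotopic (R : realType) (n n' : 'E R) (c c' : R)
    (k : set 'E R) :
  enorm n = 1 -> enorm n' = 1 ->
  ambient_isotopic k (plane_reflection n' c' @` (plane_reflection n c @` k)).
Proof.
(* The sign of [n'] may be changed together with that of [c']. Once the angle between the normals is
   not obtuse, the segment joining them misses the origin and can be normalized. *)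
move=> n1 n'1; wlog nn' : n' c' n'1 / 0 <= edot n n'.
  move=> wl; have [/wl|nn'] := leP 0 (edot n n'); first exact.
  rewrite -(plane_reflection_opp n'); apply: wl.
    by rewrite -scaleN1r enormZ normrN1 mul1r.
  by rewrite -scaleN1r edotZr mulN1r oppr_ge0 ltW.
pose m (t : R) := (1 - t) *: n + t *: n'.
pose u t := (enorm (m t))^-1 *: m t.
pose d (t : R) := (1 - t) * c + t * c'.
have m_gt0 t : t \in `[0, 1] -> 0 < enorm (m t).
  rewrite in_itv /= => /andP[t0 t1]; rewrite sqrtr_gt0.
  rewrite edotDl !edotDr !edotZl !edotZr !edot_unit// (edotC n').
  (* The squared norm is $(1-t)^2 + t^2$ plus twice this nonnegative term. *)
  have : 0 <= (1 - t) * t * edot n n' by rewrite !mulr_ge0// subr_ge0.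
  by nra.
have u1 t : t \in `[0, 1] -> enorm (u t) = 1.
  move=> t01; rewrite enormZ ger0_norm ?invr_ge0 ?sqrtr_ge0//.
  by rewrite mulVf// gt_eqF// m_gt0.
exists (fun t => plane_reflection (u t) (d t) \o plane_reflection n c); split.
- apply/subspace_continuousP => p p01; apply: cvg_within_filter.
  have p1 : q.1 @[q --> p] --> p.1 by exact: cvg_fst.
  have p2 : q.2 @[q --> p] --> p.2 by exact: cvg_snd.
  have q1 : 1 - q.1 @[q --> p] --> 1 - p.1 by apply: cvgB => //; exact: cvg_cst.
  have cm : m q.1 @[q --> p] --> m p.1 by apply: cvgD; exact: cvgZr_tmp.
  apply: cvg_plane_reflection.
  + apply: cvgZ => //; apply: cvgV; first by rewrite gt_eqF// m_gt0.
    exact: cvg_enorm.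
  + by apply: cvgD; exact: cvgMr_tmp.
  + by apply: cvg_comp p2 _; exact: plane_reflection_continuous.
- move=> t t01; apply: is_homeomorphism_comp.
    exact: plane_reflection_homeomorphism.
  by apply: plane_reflection_homeomorphism; exact: u1.
- move=> x /=; rewrite /u /d /m subr0 !scale1r !scale0r addr0 n1 invr1 scale1r.
  by rewrite mul1r mul0r addr0 plane_reflectionK.
- rewrite /u /d /m subrr !scale1r !scale0r add0r n'1 invr1 scale1r.
  by rewrite mul1r mul0r add0r image_comp.
Qed.

Lemma is_knot_type_isotopic (R : realType) (K : set (set 'E R)) (k l : set 'E R) :
  is_knot_type K -> K k -> ambient_isotopic k l -> K l.
Proof. by move=> [k0 _ ->]; exact: ambient_isotopic_trans. Qed.

Lemma enorm_delta (R : realType) (i : 'I_3) : enorm (delta_mx 0 i : 'E R) = 1.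
Proof.
rewrite /enorm edotE (bigD1 i)//= big1 => [|j ji]; last first.
  by rewrite mxE (negPf ji) andbF mul0r.
by rewrite mxE !eqxx mulr1 addr0 sqrtr1.
Qed.

(** The witness is the reflected knot reflected once more in the fixed plane: it differs from [k] by
    two reflections, hence lies in [K], and the fixed reflection takes it back to the reflected
    knot. *)
Lemma mirror_plane_reflection (R : realType) (K : set (set 'E R)) (n : 'E R)
    (c : R) (k : set 'E R) :
  is_knot_type K -> enorm n = 1 -> K k -> mirror K (plane_reflection n c @` k).
Proof.
move=> hK n1 Kk; exists (plane_reflection (delta_mx 0 ord_max) 0 @`
    (plane_reflection n c @` k)).
  apply: (is_knot_type_isotopic hK Kk).
  by apply: plane_reflections_isotopic => //; exact: enorm_delta.
by rewrite plane_reflection_image2//; exact: enorm_delta.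
Qed.

(** A knot of the mirror type is a reflected knot of [K], so one more reflection yields a product of
    two, which is isotopic to the identity. *)
Lemma plane_reflection_mirror (R : realType) (K : set (set 'E R)) (n : 'E R)
    (c : R) (k : set 'E R) :
  is_knot_type K -> enorm n = 1 -> mirror K k -> K (plane_reflection n c @` k).
Proof.
move=> hK n1 [l Kl <-]; apply: (is_knot_type_isotopic hK Kl).
by apply: plane_reflections_isotopic => //; exact: enorm_delta.
Qed.

(** * Curves under affine isometries: regularity, length, thickness *)

Lemma derive_affine (R : realType) (A : 'M[R]_3) (b : 'E R) (g : R -> 'E R)
    (t : R) :
  derivable g t 1 -> is_derive t 1 (fun s => g s *m A + b) (derive1 g t *m A).
Proof.
move=> /[dup] dg /derivable1_diffP dg'.
have dA : differentiable (mulmxr A) (g t).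
  exact/linear_differentiable/mulmxr_continuous.
have dgA : differentiable (mulmxr A \o g) t by exact: differentiable_comp.
have : is_derive t 1 (mulmxr A \o g) (derive1 g t *m A).
  apply: DeriveDef; first exact/derivable1_diffP.
  rewrite deriveE// diff_comp//= diff_lin; last exact: mulmxr_continuous.
  by rewrite /= derive1E deriveE.
move=> dh; rewrite -[_ *m A]addr0; apply: is_deriveD.
Qed.

Lemma derive1_affine (R : realType) (A : 'M[R]_3) (b : 'E R) (g : R -> 'E R) :
  (forall t, derivable g t 1) ->
  derive1 (fun t => g t *m A + b) = fun t => derive1 g t *m A.
Proof.
move=> dg; apply/funext => t; rewrite derive1E.
exact: (@derive_val _ _ _ _ _ _ _ (derive_affine A b (dg t))).
Qed.

(** An orthogonal matrix is injective and preserves norms, so it carries the unit tangent to the new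
    unit tangent and keeps its Lipschitz constant. *)
Lemma closed_C11_affine (R : realType) (A : 'M[R]_3) (b : 'E R) (g : R -> 'E R) :
  A *m A^T = 1%:M -> closed_C11 g -> closed_C11 (fun t => g t *m A + b).
Proof.
move=> AAT [[pg ig] dg cg g0 [k kg]].
have mulI (u v : 'E R) : u *m A = v *m A -> u = v.
  by move=> /(congr1 (mulmx^~ A^T)); rewrite -!mulmxA AAT !mulmx1.
have dE := derive1_affine A b dg; split.
- split=> [t|s t s02 t02 /addIr /mulI]; first by rewrite pg.
  exact: ig.
- by move=> t; have [] := derive_affine A b (dg t).
- rewrite dE => t; apply: (@continuous_comp _ _ _ (derive1 g) (mulmxr A)).
    exact: cg.
  exact: mulmxr_continuous.
- rewrite dE => t; apply: contra (g0 t) => /eqP gA0.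
  by apply/eqP/mulI; rewrite gA0 mul0mx.
- have uE t : unit_tangent (fun t => g t *m A + b) t = unit_tangent g t *m A.
    rewrite /unit_tangent dE /= enorm_mulmx; last exact: AAT.
    exact: scalemxAl.
  exists k => s t; rewrite !uE -mulmxBl enorm_mulmx; last exact: AAT.
  exact: kg.
Qed.

(** An isometry carries nearest points to nearest points. As [f] is its own inverse, one inclusion
    between the sets of admissible radii, applied to [X] and to its image, gives equality. *)
Lemma reach_isometry (R : realType) (f : 'E R -> 'E R) (X : set 'E R) :
  involutive f -> (forall x y, enorm (f x - f y) = enorm (x - y)) ->
  reach (f @` X) = reach X.
Proof.
move=> fK fd.
have incl (Z : set 'E R) (r : R) :
    (forall x a, Z a -> enorm (x - a) < r ->
      exists! b, Z b /\ forall c, Z c -> enorm (x - b) <= enorm (x - c)) ->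
    forall x a, (f @` Z) a -> enorm (x - a) < r ->
      exists! b, (f @` Z) b /\
        forall c, (f @` Z) c -> enorm (x - b) <= enorm (x - c).
  move=> hZ x _ [a Za <-]; rewrite -{1}(fK x) fd => xa.
  have [b [[Zb bmin] buniq]] := hZ _ _ Za xa.
  exists (f b); split.
    split; first by exists b.
    by move=> _ [c Zc <-]; rewrite -(fK x) !fd; exact: bmin.
  move=> _ [[b' Zb' <-] b'min]; congr f; apply: buniq; split=> // c Zc.
  by rewrite -!(fd (f x)) fK; apply: b'min; exists c.
rewrite /reach; congr sup; apply/seteqP; split=> r [r0 hr]; split=> //.
  have -> : X = f @` (f @` X).
    rewrite image_comp (_ : _ \o _ = id) ?image_id//; exact/funext.
  exact: incl.
exact: incl.
Qed.

Section reflected_curve.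
Context (R : realType) (n : 'E R) (c : R) (n1 : enorm n = 1) (g : R -> 'E R).
Let r := plane_reflection n c.

Lemma range_reflection : range (r \o g) = r @` range g.
Proof. by rewrite image_comp. Qed.

Lemma closed_C11_reflection : closed_C11 g -> closed_C11 (r \o g).
Proof.
move=> gC; rewrite /r plane_reflectionE.
exact/closed_C11_affine/gC/householder_orthogonal.
Qed.

Lemma derive1_reflection : closed_C11 g ->
  derive1 (r \o g) = fun t => derive1 g t *m householder n.
Proof. by move=> [_ dg _ _ _]; rewrite /r plane_reflectionE derive1_affine. Qed.

Lemma enorm_derive1_reflection (t : R) : closed_C11 g ->
  enorm (derive1 (r \o g) t) = enorm (derive1 g t).
Proof.
by move=> gC; rewrite derive1_reflection// enorm_mulmx// householder_orthogonal.
Qed.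

Lemma len_reflection : closed_C11 g -> len (r \o g) = len g.
Proof.
by move=> gC; apply: eq_Rintegral => t _; rewrite enorm_derive1_reflection.
Qed.

Lemma thi_reflection : thi (r \o g) = thi g.
Proof.
rewrite /thi range_reflection reach_isometry//; first exact: plane_reflectionK.
by move=> x y; exact: plane_reflection_isometry.
Qed.

Lemma ropelength_reflection : closed_C11 g -> ropelength (r \o g) = ropelength g.
Proof. by move=> gC; rewrite /ropelength len_reflection// thi_reflection. Qed.

End reflected_curve.

(** Reflection in the fixed plane exchanges the curves of the two types and keeps their ropelength,
    so both infima are over the same set of values. *)
Lemma min_ropelength_mirror (R : realType) (K : set (set 'E R)) :
  is_knot_type K -> min_ropelength (mirror K) = min_ropelength K.
Proof.
move=> hK; pose e : 'E R := delta_mx 0 ord_max.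
have e1 : enorm e = 1 by exact: enorm_delta.
congr inf; apply/seteqP; split=> _ [g [gC Kg ->]];
  exists (plane_reflection e 0 \o g); split.
- exact: closed_C11_reflection.
- rewrite range_reflection; exact: plane_reflection_mirror.
- apply/esym; exact: ropelength_reflection.
- exact: closed_C11_reflection.
- rewrite range_reflection; exact: mirror_plane_reflection.
- apply/esym; exact: ropelength_reflection.
Qed.

(** * Continuity of affine maps in the $C^1$ topology on configurations *)

Lemma affine_unif_continuous (R : realType) (A : 'M[R]_3) (b : 'E R) :
  unif_continuous (fun x : 'E R => x *m A + b).
Proof.
have [k k0 kA] := linear_lipschitz (@mulmxr_continuous R A).
apply/unif_continuousP => e e0; exists (e / k); first exact: divr_gt0.
move=> [x y]; rewrite -!ball_normE /= => xy.
rewrite opprD addrACA subrr addr0 -mulmxBl (le_lt_trans (kA _))//.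
by rewrite mulrC -ltr_pdivlMr.
Qed.

(** For uniform convergence the map [f] must pull entourages back to entourages, hence the
    hypothesis of uniform continuity. *)
Lemma uniform_postcomp_continuous (T : choiceType) (U V : uniformType)
    (f : U -> V) :
  unif_continuous f ->
  continuous (fun h : {uniform T -> U} => (f \o h : {uniform T -> V})).
Proof.
move=> fu h P /uniform_nbhs[E [entE EP]].
apply/uniform_nbhs; exists [set xy | E (f xy.1, f xy.2)]; split.
  exact: fu.
by move=> h' hh'; apply: EP => y _; exact: hh'.
Qed.

(** Covers the reflections and also, with the identity matrix and no translation, the inclusions of
    sublevels. *)
Lemma config_affine_continuous (R : realType) (K K' : set (set 'E R)) (L L' : R)
    (A : 'M[R]_3) (b : 'E R) (F : config K L -> config K' L') :
  (forall g, (F g : R -> 'E R) = fun t => g t *m A + b) -> continuous F.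
Proof.
move=> FE; apply: continuous_comp_initial.
pose u b : {uniform R -> 'E R} -> {uniform R -> 'E R} :=
  fun h => (fun x => x *m A + b) \o h.
have cu b' : continuous (u b').
  exact/uniform_postcomp_continuous/affine_unif_continuous.
(* Differentiation kills the translation, so on jets the map is affine on the curve and linear, with
   [0] in place of [b], on the derivative. *)
have -> : @jet R K' L' \o F = (fun p => (u b p.1, u 0 p.2)) \o @jet R K L.
  apply/funext => g; rewrite /jet /= FE; congr pair.
  have [_ dg _ _ _] := curve_closed_C11 g.
  rewrite derive1_affine; last exact: dg.
  by apply/funext => t; rewrite /u /= addr0.
move=> g; apply: continuous_comp; first exact: initial_continuous.
move: (jet g) => p; apply: (@cvg_pair _ _ _ _ (nbhs (u b p.1)) (nbhs (u 0 p.2))).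
  by apply: (@cvg_comp _ _ _ fst (u b)); [exact: cvg_fst|exact: cu].
by apply: (@cvg_comp _ _ _ snd (u 0)); [exact: cvg_snd|exact: cu].
Qed.

(** * Descent of maps to the quotients by congruence *)

Local Open Scope quotient_scope.

Lemma Yclass_eqP (R : realType) (K : set (set 'E R)) (L : R) (g h : config K L) :
  Yclass g = Yclass h <-> congruent g h.
Proof.
split=> [gh|gh]; last by apply/eqmodP/asboolP.
have /eqmodP/asboolP : g = h %[mod {eq_quot (config_equiv K L)}] by exact: gh.
exact.
Qed.

Lemma Yclass_repr (R : realType) (K : set (set 'E R)) (L : R) (y : Y K L) :
  Yclass (repr y) = y.
Proof. exact: reprK. Qed.

(** Configurations with the same curve may carry different proofs; reflexivity of congruence
    identifies their classes without comparing these. *)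
Lemma Yclass_eq_curve (R : realType) (K : set (set 'E R)) (L : R)
    (g h : config K L) :
  (g : R -> 'E R) = h -> Yclass g = Yclass h.
Proof. by move=> gh; apply/Yclass_eqP; rewrite gh; exact: congruent_refl. Qed.

(** Universal property of the quotient topology: compatibility with congruence makes the class
    independent of the representative chosen by [repr]. *)
Lemma Yclass_comp_continuous (R : realType) (K K' : set (set 'E R)) (L L' : R)
    (F : config K L -> config K' L') :
  continuous F -> (forall g h : config K L, congruent g h -> congruent (F g) (F h)) ->
  continuous (fun y : Y K L => Yclass (F (repr y))).
Proof.
move=> cF Fcong; apply: (@repr_comp_continuous _ _ _ (fun g => Yclass (F g))).
  by move=> g; apply: continuous_comp; [exact: cF|exact: pi_continuous].
move=> g h /eqP gh; apply/eqP/Yclass_eqP/Fcong/Yclass_eqP; exact: gh.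
Qed.

Lemma Yincl_continuous (R : realType) (K : set (set 'E R)) (L M : R)
  (LM : L <= M) : continuous (@Yincl R K L M LM).
Proof.
apply: Yclass_comp_continuous => //.
apply: (@config_affine_continuous _ _ _ _ _ 1%:M 0) => g /=.
by apply/funext => t; rewrite mulmx1 addr0.
Qed.

Lemma congruent_reflection (R : realType) (n : 'E R) (c : R) (g h : R -> 'E R) :
  enorm n = 1 -> congruent g h ->
  congruent (plane_reflection n c \o g) (plane_reflection n c \o h).
Proof.
move=> n1 [A [b [e [s [[AAT dA] hE]]]]]; rewrite plane_reflectionE.
set S := householder n; set v := _ *: n.
have SS : S *m S = 1%:M by exact: householder_sqr.
have ST : S^T = S by exact: householder_sym.
clearbody S v.
(* The rotation is conjugated by [S]; the translation is solved from $(gA + b)S + v = (gS + v)SAS +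
   b'$, using $S^2 = 1$. *)
exists (S *m A *m S), (b *m S + v - v *m (S *m A *m S)), e, s; split.
  split.
    rewrite !trmx_mul ST !mulmxA -(mulmxA (S *m A)) SS mulmx1.
    by rewrite -(mulmxA S) AAT mulmx1.
  by rewrite !det_mulmx dA mulr1 -det_mulmx SS det1.
move=> t /=; rewrite hE !mulmxDl !mulmxA -(mulmxA _ S S) SS mulmx1.
by rewrite (addrC (b *m S + v)) addrA addrK addrA.
Qed.

(** * The map induced by a reflection on the sublevels *)

Section reflected_configurations.
Context (R : realType) (n : 'E R) (c : R) (n1 : enorm n = 1).
Let r := plane_reflection n c.

(** The target is left free so that one construction gives the map from [K] to [mirror K], its
    inverse, and the self-map of an amphichiral [K]. *)
Definition reflects (K K' : set (set 'E R)) : Prop :=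
  forall k, K k -> K' (r @` k).

Context (K K' : set (set 'E R)) (KK' : reflects K K') (L : R).

Lemma reflected_constant_speed (g : config K L) : constant_speed (r \o g).
Proof.
have [v gv] := curve_constant_speed g; exists v => t.
by rewrite (enorm_derive1_reflection c n1 t (curve_closed_C11 g)).
Qed.

Lemma reflected_knot_type (g : config K L) : K' (range (r \o g)).
Proof. rewrite range_reflection; apply: KK'; exact: curve_knot_type. Qed.

Lemma reflected_thi (g : config K L) : 1 <= thi (r \o g).
Proof. rewrite thi_reflection//; exact: curve_thi. Qed.

Lemma reflected_len (g : config K L) : len (r \o g) <= L.
Proof.
by rewrite (len_reflection c n1 (curve_closed_C11 g)); exact: curve_len.
Qed.

Definition config_reflection (g : config K L) : config K' L :=
  Config (closed_C11_reflection c n1 (curve_closed_C11 g))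
    (reflected_constant_speed g) (reflected_knot_type g)
    (reflected_thi g) (reflected_len g).

Definition Yreflection (y : Y K L) : Y K' L :=
  Yclass (config_reflection (repr y)).

(** Independence of the representative: the one chosen by [repr] is congruent to [g], and reflecting
    both preserves congruence. *)
Lemma YreflectionE (g : config K L) :
  Yreflection (Yclass g) = Yclass (config_reflection g).
Proof.
apply/Yclass_eqP/congruent_reflection => //; apply/Yclass_eqP.
exact: Yclass_repr.
Qed.

Lemma Yreflection_continuous : continuous Yreflection.
Proof.
apply: Yclass_comp_continuous => [|g h]; last exact: congruent_reflection.
apply: (@config_affine_continuous _ _ _ _ _ (householder n) ((2 * c) *: n)) => g.
by rewrite /= /r plane_reflectionE.
Qed.

End reflected_configurations.

Lemma YreflectionK (R : realType) (n : 'E R) (c : R) (n1 : enorm n = 1)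
    (K K' : set (set 'E R)) (KK' : reflects n c K K') (K'K : reflects n c K' K)
    (L : R) :
  cancel (@Yreflection _ _ _ n1 _ _ KK' L) (@Yreflection _ _ _ n1 _ _ K'K L).
Proof.
move=> y; rewrite -[y]Yclass_repr !YreflectionE; apply: Yclass_eq_curve.
by apply/funext => t; exact: plane_reflectionK.
Qed.

Lemma Yreflection_incl (R : realType) (n : 'E R) (c : R) (n1 : enorm n = 1)
    (K K' : set (set 'E R)) (KK' : reflects n c K K') (L M : R) (LM : L <= M)
    (y : Y K L) :
  Yreflection n1 KK' (Yincl LM y) = Yincl LM (Yreflection n1 KK' y).
Proof.
rewrite -[y]Yclass_repr YinclE !YreflectionE YinclE; exact: Yclass_eq_curve.
Qed.

(** Once the equality of types is eliminated, the two sides differ only in the proofs stored in the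
    configurations. This removes transports from the amphichiral case. *)
Lemma Ycast_reflection (R : realType) (n : 'E R) (c : R) (n1 : enorm n = 1)
    (K K' K'' : set (set 'E R)) (e : K' = K'') (KK' : reflects n c K K')
    (KK'' : reflects n c K K'') (L : R) (y : Y K L) :
  Ycast e (Yreflection n1 KK' y) = Yreflection n1 KK'' y.
Proof.
case: K'' / e in KK'' *; rewrite /Ycast /=.
rewrite -[y]Yclass_repr !YreflectionE; exact: Yclass_eq_curve.
Qed.

(** * From involutions to the filtered $\mathbb{Z}/2$-structure *)

Lemma involutive_Z2_action (T : topologicalType) (f : T -> T) :
  continuous f -> involutive f ->
  is_Z2_action (fun (i : 'Z_2) y => if i == 0 then y else f y).
Proof.
move=> cf fK; split=> // [i j y|i]; last first.
  by case: eqP => // _ y; exact: cvg_id.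
have Z2 (k : 'Z_2) : k = 0 \/ k = 1.
  by case: k => [[|[|//]] kP]; [left|right]; apply: val_inj.
have [-> /=|-> /=] := Z2 i; first by rewrite add0r.
(* For [j = 1] the sum [1 + 1] is [0], and the law becomes the involutivity of [f]. *)
by have [-> /=|-> /=] := Z2 j; rewrite ?addr0 /= ?fK.
Qed.

Theorem proposition6p20 (R : realType) (K : set (set 'E R)) (r : 'E R -> 'E R)
    (K_knot_type : is_knot_type K) (r_reflection : is_reflection r) :
  exists tau : forall L : R, Y K L -> Y (mirror K) L,
    [/\ forall L, min_ropelength K <= L ->
          [/\ min_ropelength (mirror K) <= L,
              is_postcomposition r (tau L)
            & is_homeomorphism (tau L)],
        forall L M (LM : L <= M), min_ropelength K <= L ->
          forall y : Y K L, tau M (Yincl LM y) = Yincl LM (tau L y)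
      & forall K_amphichiral : amphichiral K,
          let tauK L (y : Y K L) : Y K L := Ycast K_amphichiral (tau L y) in
          [/\ forall L, min_ropelength K <= L ->
                continuous (tauK L) /\ involutive (tauK L),
              forall L M (LM : L <= M), min_ropelength K <= L ->
                forall y : Y K L, tauK M (Yincl LM y) = Yincl LM (tauK L y),
              exists sigma : ideal_stratum K -> ideal_stratum K,
                [/\ continuous sigma, involutive sigma
                  & forall L (mL : min_ropelength K <= L) (y : ideal_stratum K),
                      tauK L (Yincl mL y) = Yincl mL (sigma y)]
            & exists a : forall L : R, 'Z_2 -> Y K L -> Y K L,
                is_filtered_Z2_space a /\
                forall L, min_ropelength K <= L -> a L 1 =1 tauK L]].
Proof.
have [n [c [n1 rE]]] := r_reflection; subst r.
have KK' : reflects n c K (mirror K).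
  by move=> k Kk; exact: mirror_plane_reflection.
have K'K : reflects n c (mirror K) K.
  by move=> k Kk; exact: plane_reflection_mirror.
exists (fun L => @Yreflection _ _ _ n1 _ _ KK' L); split.
- move=> L mL; split; first by rewrite min_ropelength_mirror.
    by move=> g; exists (config_reflection n1 KK' g); rewrite ?YreflectionE.
  (* The inverse is induced by the same reflection, read from [mirror K] back to [K]. *)
  exists (@Yreflection _ _ _ n1 _ _ K'K L); split.
  + exact: YreflectionK.
  + exact: YreflectionK.
  + exact: Yreflection_continuous.
  + exact: Yreflection_continuous.
- by move=> L M LM _ y; exact: Yreflection_incl.
(* Amphichirality lets the reflection act from [K] to itself, so [tauK] becomes an instance of
   [Yreflection] without transport. *)
move=> e tauK; have KK : reflects n c K K by rewrite -{2}e; exact: KK'.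
have tauKE L : tauK L = @Yreflection _ _ _ n1 _ _ KK L.
  by apply/funext => y; exact: Ycast_reflection.
have tauKc L : continuous (tauK L).
  by rewrite tauKE; exact: Yreflection_continuous.
have tauKK L : involutive (tauK L) by rewrite tauKE; exact: YreflectionK.
have tauK_incl L M (LM : L <= M) y : tauK M (Yincl LM y) = Yincl LM (tauK L y).
  by rewrite !tauKE; exact: Yreflection_incl.
split.
- by move=> L _; split; [exact: tauKc|exact: tauKK].
- by move=> L M LM _ y; exact: tauK_incl.
(* The ideal stratum is the sublevel at the minimal ropelength, so its involution is [tauK] at that
   level. *)
- exists (tauK (min_ropelength K)); split; [exact: tauKc|exact: tauKK|].
  by move=> L mL y; exact: tauK_incl.
exists (fun L i y => if i == 0 then y else tauK L y); split; last by [].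
split=> [L _|L M LM _]; first exact: involutive_Z2_action (tauKc L) (tauKK L).
split; first exact: Yincl_continuous.
by move=> i y; case: ifP => // _; exact: tauK_incl.
Qed.
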